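(* Let $(V,g)$ be an inner product vector space over $k$, with $k=\mathbb{R}$ or $k=\mathbb{C}$ (possibly infinite-dimensional), and let $\varphi\in\operatorname{End}_k(V)$ be a finite potent endomorphism with $i(\varphi)\leq 1$. Then the core inverse $\varphi^{(\#)}$ of $\varphi$ is characterized by $$\varphi^{(\#)}(v)=\begin{cases}(\varphi|_{\operatorname{Im}(\varphi)})^{-1}(v) & \text{if } v\in\operatorname{Im}(\varphi),\\ 0 & \text{if } v\in[\operatorname{Im}(\varphi)]^{\perp};\end{cases}$$ that is, a linear map in $\operatorname{End}_k(V)$ is the core inverse of $\varphi$ if and only if it is given by this formula.
   Context: An endomorphism $\varphi$ of $V$ is finite potent if $\varphi^n(V)$ is finite-dimensional for some $n$. Equivalently, there is a (unique) $\varphi$-invariant decomposition $V=W_\varphi\oplus U_\varphi$ (AST-decomposition) with $\varphi|_{U_\varphi}$ nilpotent, $W_\varphi$ finite-dimensional and $\varphi|_{W_\varphi}$ an automorphism of $W_\varphi$. The index $i(\varphi)$ is the nilpotency order of $\varphi|_{U_\varphi}$; $i(\varphi)\le 1$ iff $W_\varphi=\operatorname{Im}(\varphi)$ iff $U_\varphi=\operatorname{Ker}(\varphi)$. So if $i(\varphi)\le1$, $\operatorname{Im}(\varphi)$ is finite-dimensional, $\varphi|_{\operatorname{Im}(\varphi)}$ is an automorphism of $\operatorname{Im}(\varphi)$, and $V=\operatorname{Im}(\varphi)\oplus[\operatorname{Im}(\varphi)]^\perp$. A linear map $\varphi^{(\#)}\in\operatorname{End}_k(V)$ is a core inverse of $\varphi$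 when $\varphi\circ\varphi^{(\#)}=P_{\operatorname{Im}(\varphi)}$ and $\operatorname{Im}(\varphi^{(\#)})\subseteq\operatorname{Im}(\varphi)$, where $P_{\operatorname{Im}(\varphi)}$ is the orthogonal projection onto $\operatorname{Im}(\varphi)$ induced by $V=\operatorname{Im}(\varphi)\oplus[\operatorname{Im}(\varphi)]^{\perp}$. *)

(* Defs.v *)
From HB Require Import structures.
From mathcomp Require Import all_boot all_order all_algebra.
From mathcomp Require Import complex.
From mathcomp Require Import boolp classical_sets functions reals.

Set Implicit Arguments.
Unset Strict Implicit.
Unset Printing Implicit Defensive.

Import Order.TTheory GRing.Theory Num.Theory.

Local Open Scope classical_set_scope.
Local Open Scope ring_scope.

Section LinearAlgebra.
Variables (k : fieldType) (V : lmodType k).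
Implicit Types (A W U : set V) (phi : {linear V -> V}).

Definition subspace A : Prop := GRing.submod_closed [in A].

Definition finite_dim A : Prop :=
  exists (n : nat) (e : 'I_n -> V),
    A = [set v | exists a : 'I_n -> k, v = \sum_(i < n) a i *: e i].

Definition direct_sum W U : Prop :=
  (forall v, exists w u, [/\ W w, U u & v = w + u]) /\ W `&` U = [set 0].

Definition finite_potent phi : Prop :=
  exists n : nat, finite_dim (range (iter n phi)).

Definition nilpotency_order phi U (n : nat) : Prop :=
  (forall u, U u -> iter n phi u = 0) /\
  (forall m : nat, (forall u, U u -> iter m phi u = 0) -> (n <= m)%N).

(* The decomposition V = W (+) U of Argerami, Szechtman and Tifenbach. *)
Definition AST_decomposition phi W U : Prop :=
  [/\ subspace W, subspace U & direct_sum W U] /\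
  [/\ phi @` W `<=` W, phi @` U `<=` U,
      (exists n : nat, forall u, U u -> iter n phi u = 0),
      finite_dim W & set_bij W W phi].

(* The index i(phi); the AST-decomposition, hence the value picked by [get],
   exists and is unique when phi is finite potent, and [get] returns a junk
   value otherwise.  The nilpotency order on U = 0 is 0. *)
Definition fp_index phi : nat :=
  get [set n : nat |
    exists W U, AST_decomposition phi W U /\ nilpotency_order phi U n].

End LinearAlgebra.

Section InnerProduct.
Variables (k : numFieldType) (theta : k -> k) (V : lmodType k).
Variable g : {dot V for theta}.
Implicit Types (A : set V).

Definition orth_compl A : set V := [set v | forall w, A w -> g v w = 0].

(* P v is the A-component of v in V = A (+) orth_compl A; requiring it for
   every v includes that the two spaces span V. *)
Definition is_orth_proj A (P : V -> V) : Prop :=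
  forall v, A (P v) /\ orth_compl A (v - P v).

Definition is_core_inverse (phi psi : {linear V -> V}) : Prop :=
  is_orth_proj (range phi) (phi \o psi) /\ range psi `<=` range phi.

End InnerProduct.

(* Main.v *)
Require Import Defs.
From HB Require Import structures.
From mathcomp Require Import all_boot all_order all_algebra.
From mathcomp Require Import complex.
From mathcomp Require Import boolp classical_sets functions reals.

Set Implicit Arguments.
Unset Strict Implicit.
Unset Printing Implicit Defensive.

Import Order.TTheory GRing.Theory Num.Theory.

Local Open Scope classical_set_scope.
Local Open Scope ring_scope.

(** Choose a power m for which Im (phi^m) is spanned by as few vectors as
    possible.  If some nontrivial combination of the images of these vectors
    vanished, Im (phi^(m+1)) would be spanned by fewer vectors; hence phi is
    injective, and so bijective, on W = Im (phi^m), and V = W (+) Ker (phi^m).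
    This is the AST-decomposition; when the index is at most 1 it forces
    W = Im phi, with phi bijective on it.  Since Im phi is finite-dimensional
    it has an orthogonal projection, and both characterizations then say that
    psi inverts phi on Im phi and vanishes on the orthogonal complement. *)

(** * Finite potent endomorphisms and their AST-decomposition *)

Section LinearAlgebra.
Variables (k : fieldType) (V : lmodType k).
Implicit Types (W U : set V) (phi : {linear V -> V}).

Definition lin_span n (e : 'I_n -> V) : set V :=
  [set v | exists a : 'I_n -> k, v = \sum_(i < n) a i *: e i].

Lemma mem_lin_span n (e : 'I_n -> V) i : lin_span e (e i).
Proof.
exists (fun j => (j == i)%:R).
rewrite (bigD1 i)//= eqxx scale1r big1 ?addr0// => j /negPf ->.
by rewrite scale0r.
Qed.

(** Subtracting [b j / a j] times the vanishing relation from a combination with coefficients [b]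
    cancels its term in [e j]. *)
Lemma lin_span_drop n (e : 'I_n.+1 -> V) (a : 'I_n.+1 -> k) (j : 'I_n.+1) :
  a j != 0 -> \sum_i a i *: e i = 0 -> lin_span e = lin_span (e \o lift j).
Proof.
move=> aj0 ae0; apply/seteqP; split=> v [b ->].
  exists (fun i => b (lift j i) - b j / a j * a (lift j i)).
  rewrite -[LHS]subr0 -[X in _ - X](scaler0 _ (b j / a j)).
  rewrite -[X in _ - _ *: X]ae0 scaler_sumr -sumrB.
  rewrite (bigD1_ord j)//= scalerA divfK// subrr add0r.
  by apply: eq_bigr => i _; rewrite scalerA -scalerBl.
exists (fun i => oapp b 0 (unlift j i)).
rewrite (bigD1_ord j)//= unlift_none scale0r add0r.
by apply: eq_bigr => i _; rewrite liftK.
Qed.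

Lemma iter_linearP phi n a u v :
  iter n phi (a *: u + v) = a *: iter n phi u + iter n phi v.
Proof. by elim: n => //= n ->; rewrite linearP. Qed.

Lemma iter_linear0 phi n : iter n phi 0 = 0.
Proof. by elim: n => //= n ->; rewrite linear0. Qed.

Lemma iter_linearB phi n u v : iter n phi (u - v) = iter n phi u - iter n phi v.
Proof. by rewrite addrC -scaleN1r iter_linearP scaleN1r addrC. Qed.

Lemma subspace_range_iter phi n : subspace (range (iter n phi)).
Proof.
split=> [|a _ _ /set_mem[u _ <-] /set_mem[v _ <-]]; apply/mem_set.
  by exists 0 => //; rewrite iter_linear0.
by exists (a *: u + v) => //; rewrite iter_linearP.
Qed.

Lemma subspace_ker_iter phi n : subspace [set u | iter n phi u = 0].
Proof.
split=> [|a u v /set_mem/= u0 /set_mem/= v0]; apply/mem_set => /=.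
  by rewrite iter_linear0.
by rewrite iter_linearP u0 v0 scaler0 addr0.
Qed.

Lemma minimal_spanning_range phi : finite_potent phi ->
  exists m n (e : 'I_n -> V), range (iter m phi) = lin_span e /\
    forall a : 'I_n -> k, \sum_i a i *: phi (e i) = 0 -> forall i, a i = 0.
Proof.
move=> [m0 [n0 [e0 range_e0]]].
pose P n := exists m (e : 'I_n -> V), range (iter m phi) = lin_span e.
have exP : exists n, `[< P n >] by exists n0; apply/asboolP; exists m0, e0.
have [n /asboolP[m [e range_e]] min_n] := ex_minnP exP.
exists m, n, e; split=> // a ae0 i; apply: contrapT => /eqP ai0.
case: n => [|n] in e min_n range_e a ae0 i ai0 *; first by case: i ai0.
suff /asboolP/min_n : P n by rewrite ltnn.
exists m.+1, (phi \o e \o lift i); rewrite -(lin_span_drop ai0)//.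
apply/seteqP; split=> [_ [v _ <-] /=|v [b ->]].
  have [b ->] : lin_span e (iter m phi v) by rewrite -range_e; exists v.
  by exists b; rewrite linear_sum; apply: eq_bigr => j _; rewrite linearZ.
have [x _ xE] : range (iter m phi) (\sum_j b j *: e j).
  by rewrite range_e; exists b.
exists x => //=; rewrite xE linear_sum.
by apply: eq_bigr => j _; rewrite linearZ.
Qed.

(** Let [M] express the [phi (e i)] in terms of the [e j]. Then [phi] acts on coefficient rows as
    right multiplication by [M], so it suffices to invert [M]. *)
Lemma bij_lin_span phi n (e : 'I_n -> V) :
  (forall i, lin_span e (phi (e i))) ->
  (forall a : 'I_n -> k, \sum_i a i *: phi (e i) = 0 -> forall i, a i = 0) ->
  set_bij (lin_span e) (lin_span e) phi.
Proof.
move=> /choice[M phieE] indep.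
have phi_comb (a : 'I_n -> k) :
    phi (\sum_i a i *: e i) = \sum_i a i *: phi (e i).
  by rewrite linear_sum; apply: eq_bigr => i _; rewrite linearZ.
have combM (a : 'I_n -> k) : \sum_i a i *: phi (e i) =
    \sum_j (\row_i a i *m \matrix_(i, j) M i j) 0 j *: e j.
  under eq_bigr => i _ do rewrite phieE scaler_sumr.
  rewrite exchange_big; apply: eq_bigr => j _ /=.
  rewrite mxE scaler_suml; apply: eq_bigr => i _.
  by rewrite !mxE scalerA.
split.
- by move=> _ [a ->]; rewrite phi_comb combM; eexists.
- move=> _ _ /set_mem[a ->] /set_mem[b ->]; rewrite !phi_comb => ab.
  have ab0 : \sum_i (a i - b i) *: phi (e i) = 0.
    by under eq_bigr do rewrite scalerBl; rewrite sumrB ab subrr.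
  apply: eq_bigr => i _.
  by have /eqP := indep _ ab0 i; rewrite subr_eq0 => /eqP ->.
- move=> _ [b ->].
  (* A row [v] killed by [M] is a relation between the [phi (e i)], hence zero. *)
  have Mu : \matrix_(i, j) M i j \in unitmx.
    rewrite -row_free_unit; apply: inj_row_free => v vM0.
    apply/rowP => i; rewrite mxE; apply: (indep (v 0)).
    rewrite combM (_ : \row_i v 0 i = v); last by apply/rowP => j; rewrite mxE.
    by rewrite vM0 big1// => j _; rewrite mxE scale0r.
  pose a := \row_j b j *m invmx (\matrix_(i, j) M i j).
  exists (\sum_i a 0 i *: e i); first by exists (a 0).
  rewrite phi_comb combM (_ : \row_i a 0 i = a); last first.
    by apply/rowP => j; rewrite mxE.
  by rewrite mulmxKV//; apply: eq_bigr => i _; rewrite mxE.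
Qed.

(** As [phi^m] maps W onto itself, each [v] has some [w] in W with [phi^m w = phi^m v], and [v - w]
    lies in the kernel; injectivity on W makes the sum direct. *)
Lemma finite_potent_AST phi : finite_potent phi ->
  exists W U, AST_decomposition phi W U.
Proof.
move=> /minimal_spanning_range[m [n [e [WE indep]]]].
have WP v : range (iter m phi) v -> range (iter m phi) (phi v).
  by move=> [x _ <-]; exists (phi x) => //; rewrite -iterSr.
have bijW : set_bij (range (iter m phi)) (range (iter m phi)) phi.
  rewrite WE; apply: bij_lin_span => // i; rewrite -WE; apply: WP.
  by rewrite WE; exact: mem_lin_span.
have [_ injW surjW] := bijW.
have iter_inj j v : range (iter m phi) v -> iter j phi v = 0 -> v = 0.
  elim: j v => // j IH v Wv; rewrite iterSr => /(IH _ (WP _ Wv)) phiv0.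
  apply: injW; rewrite ?linear0//; apply/mem_set => //.
  by exists 0 => //; rewrite iter_linear0.
have iter_surj j v : range (iter m phi) v ->
    exists2 w, range (iter m phi) w & iter j phi w = v.
  elim: j v => [|j IH] v Wv; first by exists v.
  by have [w /IH[x Wx <-] <-] := surjW _ Wv; exists x.
exists (range (iter m phi)), [set u | iter m phi u = 0].
split; split; [exact: subspace_range_iter | exact: subspace_ker_iter | |
  by move=> _ [v Wv <-]; exact: WP | | by exists m | by exists n, e | by []].
- split=> [v|]; last first.
    apply/seteqP; split=> [v [Wv /(iter_inj _ _ Wv)]//|_ ->].
    by split; [exists 0 => //|]; rewrite /= iter_linear0.
  have /(iter_surj m)[w Ww wv] : range (iter m phi) (iter m phi v) by exists v.
  exists w, (v - w); split=> //=; last by rewrite addrC subrK.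
  by rewrite iter_linearB wv subrr.
- by move=> _ [u /= u0 <-] /=; rewrite -iterSr /= u0 linear0.
Qed.

Lemma fp_index_spec phi : finite_potent phi ->
  exists W U,
    AST_decomposition phi W U /\ nilpotency_order phi U (fp_index phi).
Proof.
move=> /finite_potent_AST[W [U WU]]; rewrite /fp_index.
apply: (@getPex _ [set n | exists W U, AST_decomposition phi W U /\
  nilpotency_order phi U n]).
have [_ [_ _ [n0 nil_n0] _ _]] := WU.
(* The least exponent that kills U shows that [get] chooses from a nonempty set. *)
have exN : exists n, `[< forall u, U u -> iter n phi u = 0 >].
  by exists n0; apply/asboolP.
have [n /asboolP nil_n min_n] := ex_minnP exN.
exists n, W, U; split=> //; split=> // m nil_m.
by apply: min_n; apply/asboolP.
Qed.

Lemma range_index_le1 phi : finite_potent phi -> (fp_index phi <= 1)%N ->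
  finite_dim (range phi) /\ set_bij (range phi) (range phi) phi.
Proof.
move=> /fp_index_spec[W [U [[[_ _ [WU _]] [phiW _ _ fW bijW]] [nilU _]]]] le1.
(* Index 0 forces [u = 0]; index 1 says directly that [phi] kills U. *)
have phiU u : U u -> phi u = 0.
  by move=> /nilU; case: fp_index le1 => [|[|]]//= _ ->; rewrite linear0.
suff -> : range phi = W by [].
have [_ _ surjW] := bijW.
apply/seteqP; split=> [_ [v _ <-]|v /surjW[w _ <-]]; last by exists w.
have [w [u [Ww Uu ->]]] := WU v.
by rewrite linearD (phiU u)// addr0; apply: phiW; exists w.
Qed.

End LinearAlgebra.

(** * Orthogonal projections and the core inverse *)

Section InnerProduct.
Variables (k : numFieldType) (theta : k -> k) (V : lmodType k).
Variable g : {dot V for theta}.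

Lemma dot_eq0 v : g v v = 0 -> v = 0.
Proof.
move=> gv0; apply/eqP/negP => /negP/(neq0_dnorm_gt0 (s:=g)).
by rewrite gv0 ltxx.
Qed.

Lemma dot_lin_span0 n (e : 'I_n -> V) v :
  (forall i, g v (e i) = 0) -> orth_compl g (lin_span e) v.
Proof.
move=> ve0 _ [a ->]; rewrite linear_sumr big1// => i _.
by rewrite linearZr_LR /= ve0 mulr0.
Qed.

(** Induction on the number of spanning vectors, which may be dependent. *)
Lemma orth_decomposition (A : set V) : finite_dim A ->
  forall v, exists2 w, A w & orth_compl g A (v - w).
Proof.
move=> [n [e ->]]; rewrite -/(lin_span e).
elim: n e => [|n IH] e v.
  exists 0; last by apply: dot_lin_span0 => -[].
  by exists (fun=> 0); rewrite big_ord0.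
pose e' := e \o lift ord0.
(* Gram-Schmidt: q is the component of the new vector orthogonal to e'. *)
have [_ [b ->]] := IH e' (e ord0); set p := \sum_i _ => q_orth.
have [_ [a ->]] := IH e' v; set w := \sum_i _ => r_orth.
set q := e ord0 - p in q_orth; set r := v - w in r_orth.
pose c := g r q / g q q.
have e'_in := mem_lin_span e'.
have r'e' i : g (r - c *: q) (e' i) = 0.
  by rewrite linearBl linearZl_LR /= r_orth ?q_orth ?mulr0 ?subr0.
have r'q : g (r - c *: q) q = 0.
  rewrite linearBl linearZl_LR /= /c.
  (* If [e ord0] already lies in the span of [e'], then [q = 0] and both terms vanish, whatever [c]
     is. *)
  have [/dot_eq0 ->|gq0] := eqVneq (g q q) 0.
    by rewrite !linear0r mulr0 subr0.
  by rewrite divfK// subrr.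
exists (w + c *: q).
  (* Coefficients from expanding [w + c *: (e ord0 - p)]: [c] at [ord0], [a j - c * b j]
     elsewhere. *)
  exists (fun i => oapp (fun j => a j - c * b j) c (unlift ord0 i)).
  rewrite big_ord_recl unlift_none /= /q scalerBr addrCA; congr (_ + _).
  rewrite scaler_sumr -sumrB; apply: eq_bigr => i _.
  by rewrite liftK /= scalerBl scalerA.
rewrite opprD addrA -/r; apply: dot_lin_span0 => i.
have [j ->|->] := unliftP ord0 i; first exact: r'e'.
rewrite -(subrK p (e ord0)) -/q linearDr [X in X + _]r'q add0r.
by apply: (dot_lin_span0 r'e'); exists b.
Qed.

Lemma core_inverseP (phi psi : {linear V -> V}) :
  finite_dim (range phi) -> set_bij (range phi) (range phi) phi ->
  is_core_inverse g phi psi <->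
  (forall v, (range phi v -> psi v = 'pinv_(fun=> 0) (range phi) phi v) /\
             (orth_compl g (range phi) v -> psi v = 0)).
Proof.
move=> fin [_ inj surj].
have range0 : range phi 0 by exists 0 => //; rewrite linear0.
have rangeB u v : range phi u -> range phi v -> range phi (u - v).
  by move=> [x _ <-] [y _ <-]; exists (x - y) => //; rewrite linearB.
(* Injectivity on the range makes the partial inverse a true one there; its default 0 never
   intervenes. *)
have pinv_phi x : range phi x -> 'pinv_(fun=> 0) (range phi) phi (phi x) = x.
  by move=> phix; apply: pinvKV => //; apply/mem_set.
have orthB u v : orth_compl g (range phi) u -> orth_compl g (range phi) v ->
    orth_compl g (range phi) (u - v).
  move=> uo vo w Rw.
  by rewrite linearBl [X in X - _]uo// [X in _ - X]vo// subr0.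
have orth_eq0 v : range phi v -> orth_compl g (range phi) v -> v = 0.
  by move=> Rv vo; apply: dot_eq0; exact: vo.
split=> [[proj sub] v|psiE].
- have Rpsi : range phi (psi v) by apply: sub; exists v.
  have [/= Rp po] := proj v.
  split=> [Rv|vo].
    (* It remains to see [phi (psi v) = v]: the difference lies in the range and in its
       complement. *)
    rewrite -[LHS]pinv_phi//; congr ('pinv_ _ _ _ _).
    apply/eqP; rewrite eq_sym -subr_eq0; apply/eqP/orth_eq0 => //.
    exact: rangeB.
  (* Here [phi (psi v)] is itself orthogonal to the range, being [v - (v - phi (psi v))], so it is
     0. *)
  apply: inj; [exact/mem_set|exact/mem_set|rewrite linear0].
  apply: orth_eq0 => //.
  by rewrite -[phi _](subKr v); exact: orthB.
- have psi_phi x : range phi x -> psi (phi x) = x.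
    by move=> Rx; rewrite (psiE _).1 ?pinv_phi//; exists x.
  (* Such an [x] yields both conditions: [psi v] is in the range and [phi (psi v)] is the projection
     of [v]. *)
  suff key v : exists x, [/\ range phi x, psi v = x &
      orth_compl g (range phi) (v - phi x)].
    split=> [v|_ [v _ <-]]; have [x [Rx psiv vo]] := key v; rewrite /= psiv//.
    by split=> //; exists x.
  have [w /surj[x Rx <-] vo] := orth_decomposition fin v.
  exists x; split=> //.
  by rewrite -[v in LHS](subrK (phi x)) linearD psi_phi// (psiE _).2// add0r.
Qed.

End InnerProduct.

Theorem theorem4p5 (R : realType) :
  (forall (V : lmodType R) (g : {dot V for idfun}) (phi : {linear V -> V}),
     finite_potent phi -> (fp_index phi <= 1)%N ->
     forall psi : {linear V -> V},
       is_core_inverse g phi psi <->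
       (forall v, (range phi v -> psi v = 'pinv_(fun=> 0) (range phi) phi v) /\
                  (orth_compl g (range phi) v -> psi v = 0)))
  /\
  (forall (V : lmodType R[i]) (g : {dot V for Num.conj}) (phi : {linear V -> V}),
     finite_potent phi -> (fp_index phi <= 1)%N ->
     forall psi : {linear V -> V},
       is_core_inverse g phi psi <->
       (forall v, (range phi v -> psi v = 'pinv_(fun=> 0) (range phi) phi v) /\
                  (orth_compl g (range phi) v -> psi v = 0))).
Proof.
by split=> V g phi fp le1 psi; have [fin bij] := range_index_le1 fp le1;
  exact: core_inverseP.
Qed.
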